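(* Consider the hyper group $(\mathcal M,\hat+)$ of all real matrices, with identity set $\mathbf e=\{0_{m\times n}:m,n\ge1\}$, and the maps $\pi_s,\pi_a:\mathcal M\to\mathcal M$, $$\pi_s(A)=\tfrac12(A\hat+A^T),\qquad \pi_a(A)=\tfrac12(A\hat-A^T).$$ Let $K^s=\{A\in\mathcal M:\pi_s(A)=0\}$, $K^a=\{A\in\mathcal M:\pi_a(A)=0\}$ (where $=0$ means being a zero matrix), and $K^s_{m\times n}=K^s\cap\mathcal M_{m\times n}$, $K^a_{m\times n}=K^a\cap\mathcal M_{m\times n}$. Then: (i) $\pi_s$ and $\pi_a$ are hyper group homomorphisms (endomorphisms) of $(\mathcal M,\hat+)$, and their kernels $K^s$, $K^a$ are hyper groups (under $\hat+$). (ii) For $A\in K^s\cap\mathcal M_{m\times n}$ and $\alpha=\mathrm{lcm}(m,n)$: $\pi_a(A)=A\otimes E_{\alpha/m\times\alpha/n}$. (iii) $K^s_{n\times n}$ is the set of $n\times n$ skew-symmetric matrices. (iv) For $A\in K^a\cap\mathcal M_{m\times n}$ and $\alpha=\mathrm{lcm}(m,n)$: $\pi_s(A)=A\otimes E_{\alpha/m\times\alpha/n}$. (v) $K^a_{n\times n}$ is the set of $n\times n$ symmetric matrices.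
   Context: $\mathcal M_{m\times n}$: real $m\times n$ matrices; $\mathcal M=\bigcup_{m,n\ge1}\mathcal M_{m\times n}$; $\otimes$: Kronecker product; $E_{m\times n}$: the $m\times n$ matrix with all entries $1/\sqrt{mn}$. For $A\in\mathcal M_{m\times n},B\in\mathcal M_{p\times q},s=\mathrm{lcm}(m,p),t=\mathrm{lcm}(n,q)$: $A\hat\pm B=(A\otimes E_{s/m\times t/n})\pm(B\otimes E_{s/p\times t/q})$. The identity set $\mathbf e=\{0_{m\times n}\}$ is ordered by componentwise divisibility of $(m,n)$. Hyper group: Let $(G,* )$ be a semigroup. A subset $\mathbf e\subset G$ is an identity set if (i) $g*e=e*g$ for all $g\in G$, $e\in\mathbf e$; (ii) $\mathbf e=\{e_\lambda:\lambda\in\Lambda\}$ is indexed without repetition by a lattice $(\Lambda,\le)$ and $e_\lambda*e_\mu=e_{\lambda\vee\mu}$; (iii) for each $g\in G$ there is a unique $e_g=e_{\lambda_g}\in\mathbf e$ such that for all $\lambda\in\Lambda$: $e_\lambda*g=g$ if and only if $\lambda\le\lambda_g$. A hyper group is a semigroup with an identity set such that for each $g$ there is $g^{-1}\in G$ with $g*g^{-1}=g^{-1}*g=e_g$. Hyper group homomorphism $\pi:(G^1,\times^1,\mathbf e^1)\to(G^2,\times^2,\mathbf e^2)$: a map with $\pi(x\times^1y)=\pi(x)\times^2\pi(y)$, $\pi(\mathbf e^1)\subset\mathbf e^2$, and $\pi:\mathbf e^1\to\mathbf e^2$ order preserving (for the non-strict lattice orders). *)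

(* Defs.v *)
From HB Require Import structures.
From mathcomp Require Import all_boot all_order all_algebra.
From mathcomp Require Import mxtens.
From mathcomp Require Import boolp classical_sets reals.

Set Implicit Arguments.
Unset Strict Implicit.
Unset Printing Implicit Defensive.

Import Order.TTheory GRing.Theory Num.Theory.
Local Open Scope classical_set_scope.
Local Open Scope ring_scope.

(* The carrier is a set [G] of an ambient type, so that subsets such as kernels
   can be hyper groups under the ambient operation.  The identity set is given
   by its indexing family [e : L -> T]; as a subset it is [range e]. *)
Section HyperGroup.
Context {d : Order.disp_t} {L : latticeType d} {T : Type}.
Variables (op : T -> T -> T) (G : set T) (e : L -> T).

Definition semigroup_on : Prop :=
  (forall x y, G x -> G y -> G (op x y)) /\
  (forall x y z, G x -> G y -> G z -> op x (op y z) = op (op x y) z).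

(* [e l] is the element written e_g in the definition of a hyper group. *)
Definition is_identity_index (g : T) (l : L) : Prop :=
  forall k : L, op (e k) g = g <-> (k <= l)%O.

Record identity_set : Prop := IdentitySet {
  identity_sub : range e `<=` G;
  identity_comm : forall g l, G g -> op g (e l) = op (e l) g;
  identity_inj : injective e;
  identity_join : forall l k, op (e l) (e k) = e (l `|` k)%O;
  identity_ex1 : forall g, G g -> exists! l, is_identity_index g l }.

Record hyper_group : Prop := HyperGroup {
  hyper_group_semigroup : semigroup_on;
  hyper_group_identity : identity_set;
  hyper_group_inv : forall g l, G g -> is_identity_index g l ->
    exists h, [/\ G h, op g h = e l & op h g = e l] }.

End HyperGroup.

Record hyper_group_hom d1 (L1 : latticeType d1) (T1 : Type)
    (op1 : T1 -> T1 -> T1) (G1 : set T1) (e1 : L1 -> T1)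
    d2 (L2 : latticeType d2) (T2 : Type)
    (op2 : T2 -> T2 -> T2) (G2 : set T2) (e2 : L2 -> T2)
    (f : T1 -> T2) : Prop := HyperGroupHom {
  hom_source : hyper_group op1 G1 e1;
  hom_target : hyper_group op2 G2 e2;
  hom_maps : forall x, G1 x -> G2 (f x);
  hom_morph : forall x y, G1 x -> G1 y -> f (op1 x y) = op2 (f x) (f y);
  hom_identity : f @` range e1 `<=` range e2;
  hom_mono : forall l k l' k', f (e1 l) = e2 l' -> f (e1 k) = e2 k' ->
    (l <= k)%O -> (l' <= k')%O }.

Definition natdvd_pos : {pred natdvd} := fun n => (0 < n)%N.

Record posdvd := PosDvd { posdvd_val :> natdvd; posdvd_gt0 : natdvd_pos posdvd_val }.
HB.instance Definition _ := [isSub for posdvd_val].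
HB.instance Definition _ := [Choice of posdvd by <:].

Fact natdvd_pos_meet : {in natdvd_pos &, forall u v, (u `&` v)%O \in natdvd_pos}.
Proof. by move=> u v u0 v0; rewrite -topredE /= /natdvd_pos -[(_ `&` _)%O]/(gcdn u v) gcdn_gt0; apply/orP; left. Qed.

Fact natdvd_pos_join : {in natdvd_pos &, forall u v, (u `|` v)%O \in natdvd_pos}.
Proof.
move=> u v u0 v0; rewrite -topredE /= /natdvd_pos -[(_ `|` _)%O]/(lcmn u v).
by rewrite lcmn_gt0; apply/andP; split.
Qed.

HB.instance Definition _ := Order.SubChoice_isSubLattice.Build _ natdvd
  natdvd_pos Order.dvd_display posdvd natdvd_pos_meet natdvd_pos_join.

Definition msize := (posdvd *p posdvd)%type.

Lemma msize_le (s t : msize) :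
  (s <= t)%O =
  ((posdvd_val s.1 : nat) %| posdvd_val t.1)%N &&
  ((posdvd_val s.2 : nat) %| posdvd_val t.2)%N.
Proof. by []. Qed.

Lemma msize_join (s t : msize) :
  (posdvd_val (s `|` t)%O.1 = lcmn (posdvd_val s.1) (posdvd_val t.1)) *
  (posdvd_val (s `|` t)%O.2 = lcmn (posdvd_val s.2) (posdvd_val t.2)).
Proof. by []. Qed.

Section Matrices.
Variable R : realType.

Record mat := Mat {
  nrow : nat;
  ncol : nat;
  nrow_gt0 : (0 < nrow)%N;
  ncol_gt0 : (0 < ncol)%N;
  mx : 'M[R]_(nrow, ncol) }.

Definition mat_of m n (m0 : (0 < m)%N) (n0 : (0 < n)%N) (A : 'M[R]_(m, n)) :
  mat := Mat m0 n0 A.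

(* Matrices packed with their size and no positivity proof: equality in [anymx]
   means same size and same entries. *)
Definition anymx := {s : nat * nat & 'M[R]_(s.1, s.2)}.
Definition pack m n (A : 'M[R]_(m, n)) : anymx :=
  existT (fun s : nat * nat => 'M[R]_(s.1, s.2)) (m, n) A.

Definition mats m n : set mat := [set A | nrow A = m /\ ncol A = n].

Definition normE k l : 'M[R]_(k, l) := const_mx (1 / Num.sqrt (k * l)%N%:R).

Lemma muln_divn m s : (m %| s)%N -> (m * (s %/ m) = s)%N.
Proof. by move=> /divnK; rewrite mulnC. Qed.

(* the s x t matrix A (x) E_{s/m x t/n} *)
Definition inflate m n s t (ms : (m %| s)%N) (nt : (n %| t)%N) (A : 'M[R]_(m, n)) :
  'M[R]_(s, t) :=
  castmx (muln_divn ms, muln_divn nt) (A *t normE (s %/ m)%N (t %/ n)%N).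

Lemma lcmn_pos m n : (0 < m)%N -> (0 < n)%N -> (0 < lcmn m n)%N.
Proof. by rewrite lcmn_gt0 => -> ->. Qed.

Definition hadd (A B : mat) : mat :=
  Mat (lcmn_pos (nrow_gt0 A) (nrow_gt0 B)) (lcmn_pos (ncol_gt0 A) (ncol_gt0 B))
    (inflate (dvdn_lcml _ _) (dvdn_lcml _ _) (mx A)
     + inflate (dvdn_lcmr _ _) (dvdn_lcmr _ _) (mx B)).

Definition hsub (A B : mat) : mat :=
  Mat (lcmn_pos (nrow_gt0 A) (nrow_gt0 B)) (lcmn_pos (ncol_gt0 A) (ncol_gt0 B))
    (inflate (dvdn_lcml _ _) (dvdn_lcml _ _) (mx A)
     - inflate (dvdn_lcmr _ _) (dvdn_lcmr _ _) (mx B)).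

Definition hscale (c : R) (A : mat) : mat :=
  Mat (nrow_gt0 A) (ncol_gt0 A) (c *: mx A).

Definition htr (A : mat) : mat := Mat (ncol_gt0 A) (nrow_gt0 A) (mx A)^T.

Definition zeromat (s : msize) : mat := Mat (posdvd_gt0 s.1) (posdvd_gt0 s.2) 0.

Definition pi_s (A : mat) : mat := hscale (1 / 2) (hadd A (htr A)).
Definition pi_a (A : mat) : mat := hscale (1 / 2) (hsub A (htr A)).

Definition Ks : set mat := [set A | mx (pi_s A) = 0].
Definition Ka : set mat := [set A | mx (pi_a A) = 0].

End Matrices.

Arguments mats : clear implicits.
Arguments normE : clear implicits.
Arguments Ks : clear implicits.
Arguments Ka : clear implicits.

(* Main.v *)
Require Import Defs.
From HB Require Import structures.
From mathcomp Require Import all_boot all_order all_algebra.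
From mathcomp Require Import mxtens.
From mathcomp Require Import boolp classical_sets reals.
Import Order.TTheory GRing.Theory Num.Theory.
Local Open Scope classical_set_scope.
Local Open Scope ring_scope.

(** The whole theorem follows from one change of viewpoint.  Cut the unit square
    into an m x n grid and read an m x n matrix A as the step function that is
    constant, equal to sqrt(mn) * A i j, on the cell (i, j).  Tensoring with
    E_{s/m x t/n} refines the grid to s x t and divides each entry by
    sqrt((st)/(mn)), which is exactly what keeps the step function unchanged
    ([step_inflate]).  Hence A |-> (size of A, step function of A) turns the
    operation of the hyper group into (join of sizes, pointwise sum), it is
    injective ([mat_ext]), and M becomes a subset of the product of the
    divisibility lattice by a vector space of functions.

    In these coordinates the axioms are those of a lattice and of a vector space:
    e_k + g = g says that k joined with the size of g is the size of g, so that
    e_g is the zero matrix of the size of g, and the inverse is the opposite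
    matrix ([hyper_group_of_closed]).

    Transposing a matrix swaps the two numbers of its size and the two variables
    of its step function.  So both maps of the theorem are, for c = 1 and c = -1,
    the map [sympart] c that sends (l, u) to
    (l joined with l swapped, (u(x, y) + c u(y, x)) / 2), which is additive in u
    and a monotone join morphism in l: an endomorphism.  Its kernel consists of
    the A with u(x, y) = - c u(y, x); there [sympart] (-c) fixes the step function
    and only enlarges the size, which means that it is a refinement of the grid.
    For square A nothing is enlarged and the kernel condition is A + c A^T = 0. *)

Section StepFunctions.
Set Implicit Arguments.
Unset Strict Implicit.
Unset Printing Implicit Defensive.
Variable R : realType.
Implicit Types A B : mat R.

(** * Matrices as step functions *)

(** Reading out-of-range entries as 0 makes the index formulas below hold for
    all natural numbers, with no bound to carry around. *)
Definition entry m n (A : 'M[R]_(m, n)) (i j : nat) : R :=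
  if insub i is Some i' then
    if insub j is Some j' then A i' j' else 0
  else 0.

Lemma entry_ord m n (A : 'M[R]_(m, n)) (i : 'I_m) (j : 'I_n) :
  entry A i j = A i j.
Proof. by rewrite /entry !valK. Qed.

Lemma entryP m n (A B : 'M[R]_(m, n)) : entry A =2 entry B -> A = B.
Proof. by move=> AB; apply/matrixP => i j; rewrite -!entry_ord. Qed.

Lemma entry0 m n i j : entry (0 : 'M[R]_(m, n)) i j = 0.
Proof.
rewrite /entry; case: insubP => // ? _ _.
by case: insubP => // ? _ _; rewrite mxE.
Qed.

Lemma entryD m n (A B : 'M[R]_(m, n)) i j :
  entry (A + B) i j = entry A i j + entry B i j.
Proof.
by rewrite /entry; case: insubP => [? _ _|_]; [case: insubP => [? _ _|_]|];
  rewrite ?mxE ?addr0.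
Qed.

Lemma entryZ m n c (A : 'M[R]_(m, n)) i j :
  entry (c *: A) i j = c * entry A i j.
Proof.
by rewrite /entry; case: insubP => [? _ _|_]; [case: insubP => [? _ _|_]|];
  rewrite ?mxE ?mulr0.
Qed.

Lemma entry_tr m n (A : 'M[R]_(m, n)) i j : entry A^T i j = entry A j i.
Proof. by rewrite /entry; do 2![case: insubP => [? _ _|_]]; rewrite ?mxE. Qed.

Lemma entry_cast m n m' n' (e : (m = m') * (n = n')) (A : 'M[R]_(m, n)) i j :
  entry (castmx e A) i j = entry A i j.
Proof. by case: e => em en; case: m' / em; case: n' / en. Qed.

Lemma entry_tens m n k l (A : 'M[R]_(m, n)) i j : (0 < k)%N -> (0 < l)%N ->
  entry (A *t normE R k l) i j
  = entry A (i %/ k)%N (j %/ l)%N / Num.sqrt (k * l)%:R.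
Proof.
move=> k0 l0; rewrite /entry.
case: insubP => [i' im ii'|].
  have imk : (i %/ k < m)%N by rewrite ltn_divLR.
  rewrite (insubT (fun x => x < m)%N imk) /=.
  case: insubP => [j' jn jj'|].
    have jnl : (j %/ l < n)%N by rewrite ltn_divLR.
    rewrite (insubT (fun x => x < n)%N jnl) /= !mxE mul1r.
    by congr (A _ _ / _); apply: val_inj; rewrite /= ?ii' ?jj'.
  rewrite -leqNgt -leq_divRL // => nj; rewrite insubF ?mul0r //.
  by rewrite ltnNge nj.
rewrite -leqNgt -leq_divRL // => mi; rewrite insubF ?mul0r //.
by rewrite ltnNge mi.
Qed.

(** The value at the point (i/k, j/l), where [x] is (i, k) and [y] is (j, l): the
    row containing i/k is the integer part of m * i / k.  Pairs of naturals give
    all the rational points, which is enough to tell step functions apart, and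
    k = 0 is harmless as it stands for the point 0. *)
Definition step A (x y : nat * nat) : R :=
  Num.sqrt (nrow A * ncol A)%:R
  * entry (mx A) ((nrow A * x.1) %/ x.2)%N ((ncol A * y.1) %/ y.2)%N.

Definition size_of A : msize :=
  (PosDvd (nrow_gt0 A : natdvd_pos _), PosDvd (ncol_gt0 A : natdvd_pos _)).

Lemma sqrt_natr_neq0 m n : (0 < m)%N -> (0 < n)%N ->
  Num.sqrt (m * n)%:R != 0 :> R.
Proof. by move=> m0 n0; rewrite gt_eqF // sqrtr_gt0 ltr0n muln_gt0 m0. Qed.

Lemma step_inj m n (m0 : (0 < m)%N) (n0 : (0 < n)%N) (A B : 'M[R]_(m, n)) :
  step (Mat m0 n0 A) =2 step (Mat m0 n0 B) -> A = B.
Proof.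
(* the cell (i, j) is sampled at its corner (i/m, j/n) *)
move=> AB; apply: entryP => i j; move: (AB (i, m) (j, n)).
by rewrite /step /= !mulKn // => /(mulfI (sqrt_natr_neq0 m0 n0)).
Qed.

Lemma size_of_eq A B :
  nrow A = nrow B -> ncol A = ncol B -> size_of A = size_of B.
Proof. by move=> r c; congr pair; apply: val_inj. Qed.

(** Equal sizes make the cells comparable, and the value on each cell is the
    entry up to the nonzero factor sqrt(mn). *)
Lemma mat_ext A B : size_of A = size_of B -> step A =2 step B -> A = B.
Proof.
case: A B => [m n m0 n0 A] [m' n' m0' n0' B] [em en].
case: m' / em m0' B => m0'; case: n' / en n0' => n0' B.
rewrite (eq_irrelevance m0' m0) (eq_irrelevance n0' n0).
by move=> /step_inj ->.
Qed.

(** Refining the grid does not change the step function: the refined row of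
    i/k, divided by s/m, is the original one, and the factor of E makes up for the
    change of the normalization from sqrt(mn) to sqrt(st). *)
Lemma step_inflate m n s t (m0 : (0 < m)%N) (n0 : (0 < n)%N)
    (s0 : (0 < s)%N) (t0 : (0 < t)%N) (ms : (m %| s)%N) (nt : (n %| t)%N)
    (A : 'M[R]_(m, n)) :
  step (Mat s0 t0 (inflate ms nt A)) =2 step (Mat m0 n0 A).
Proof.
move=> x y; rewrite /step /inflate /= entry_cast.
have s'0 : (0 < s %/ m)%N by rewrite divn_gt0 // dvdn_leq.
have t'0 : (0 < t %/ n)%N by rewrite divn_gt0 // dvdn_leq.
rewrite entry_tens //.
have index (a b : nat) (z : nat * nat) : (0 < b %/ a)%N -> (a %| b)%N ->
    ((b * z.1) %/ z.2 %/ (b %/ a) = (a * z.1) %/ z.2)%N.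
  move=> d0 /muln_divn e; rewrite -divnMA -{1}e mulnAC divnMr //.
rewrite !index // mulrCA mulrC; congr (_ * _).
have -> : (s * t = m * n * ((s %/ m) * (t %/ n)))%N.
  by rewrite mulnACA !muln_divn.
by rewrite natrM sqrtrM ?ler0n // mulfK // sqrt_natr_neq0.
Qed.

Lemma step_addmx m n (m0 : (0 < m)%N) (n0 : (0 < n)%N) (A B : 'M[R]_(m, n)) x y :
  step (Mat m0 n0 (A + B)) x y = step (Mat m0 n0 A) x y + step (Mat m0 n0 B) x y.
Proof. by rewrite /step /= entryD mulrDr. Qed.

Lemma step_hscale c A x y : step (hscale c A) x y = c * step A x y.
Proof. by rewrite /step /= entryZ mulrCA. Qed.

Lemma step_hadd A B x y : step (hadd A B) x y = step A x y + step B x y.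
Proof.
by case: A B => [m n m0 n0 A] [p q p0 q0 B]; rewrite step_addmx !step_inflate.
Qed.

Lemma step_htr A x y : step (htr A) x y = step A y x.
Proof. by rewrite /step /= entry_tr mulnC. Qed.

Lemma step_zeromat l x y : step (zeromat R l) x y = 0.
Proof. by rewrite /step entry0 mulr0. Qed.

Lemma mat_of_size m n (m0 : (0 < m)%N) (n0 : (0 < n)%N) A :
  mats R m n A -> exists B : 'M_(m, n), A = mat_of m0 n0 B.
Proof.
case: A => [m' n' m0' n0' A] [/= em en].
case: m / em m0 => m0; case: n / en n0 => n0; exists A.
by rewrite (eq_irrelevance m0' m0) (eq_irrelevance n0' n0).
Qed.

Lemma mx_eq0P A : mx A = 0 <-> forall x y, step A x y = 0.
Proof.
split=> [A0 x y|]; first by rewrite /step A0 entry0 mulr0.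
case: A => m n m0 n0 A A0 /=; apply: (@step_inj _ _ m0 n0) => x y.
by rewrite A0 /step entry0 mulr0.
Qed.

Lemma size_hadd A B : size_of (hadd A B) = (size_of A `|` size_of B)%O.
Proof. by congr pair; apply: val_inj. Qed.

Lemma size_hscale c A : size_of (hscale c A) = size_of A.
Proof. by []. Qed.

Lemma size_zeromat l : size_of (zeromat R l) = l.
Proof. by case: l => -[l1 p1] [l2 p2]. Qed.

Lemma hsubE A B : hsub A B = hadd A (hscale (- 1) B).
Proof.
apply: mat_ext => [//|x y].
case: A B => [m n m0 n0 A] [p q p0 q0 B]; rewrite step_hadd step_hscale mulN1r.
rewrite -(step_inflate p0 q0 (lcmn_pos m0 p0) (lcmn_pos n0 q0)
            (dvdn_lcmr _ _) (dvdn_lcmr _ _)).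
rewrite /hsub -scaleN1r step_addmx step_inflate; congr (_ + _).
by rewrite (step_hscale _ (Mat _ _ _)) mulN1r.
Qed.

(** * Hyper groups of matrices *)

Lemma haddC A B : hadd A B = hadd B A.
Proof.
apply: mat_ext => [|x y]; first by rewrite !size_hadd joinC.
by rewrite !step_hadd addrC.
Qed.

Lemma haddA A B C : hadd A (hadd B C) = hadd (hadd A B) C.
Proof.
apply: mat_ext => [|x y]; first by rewrite !size_hadd joinA.
by rewrite !step_hadd addrA.
Qed.

Lemma haddNr A : hadd A (hscale (- 1) A) = zeromat R (size_of A).
Proof.
apply: mat_ext => [|x y]; first by rewrite size_hadd size_zeromat joinxx.
by rewrite step_hadd step_hscale step_zeromat mulN1r subrr.
Qed.

Lemma zeromatD l k : hadd (zeromat R l) (zeromat R k) = zeromat R (l `|` k)%O.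
Proof.
apply: mat_ext => [|x y]; first by rewrite size_hadd !size_zeromat.
by rewrite step_hadd !step_zeromat addr0.
Qed.

Lemma zeromat_inj : injective (@zeromat R).
Proof. by move=> l k lk; rewrite -[l]size_zeromat lk size_zeromat. Qed.

Lemma zeromat_absorb A k : hadd (zeromat R k) A = A <-> (k <= size_of A)%O.
Proof.
rewrite leEjoin; split=> [/(congr1 size_of)|/eqP kA].
  by rewrite size_hadd size_zeromat => /eqP.
apply: mat_ext => [|x y]; first by rewrite size_hadd size_zeromat.
by rewrite step_hadd step_zeromat add0r.
Qed.

Lemma identity_indexP A l :
  is_identity_index (@hadd R) (@zeromat R) A l <-> l = size_of A.
Proof.
split=> [idx|-> k]; last exact: zeromat_absorb.
apply/le_anti/andP; split; first by apply/zeromat_absorb/idx.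
exact/idx/zeromat_absorb.
Qed.

(** The identity attached to A is the zero matrix of the size of A whatever set
    of matrices is considered, so only closure is left to check on each one. *)
Lemma hyper_group_of_closed (G : set (mat R)) :
    (forall l, G (zeromat R l)) ->
    (forall A B, G A -> G B -> G (hadd A B)) ->
    (forall A, G A -> G (hscale (- 1) A)) ->
  hyper_group (@hadd R) G (@zeromat R).
Proof.
move=> G0 GD GN; split.
- by split=> // A B C _ _ _; exact: haddA.
- split.
  + by move=> _ [l _ <-].
  + by move=> A l _; exact: haddC.
  + exact: zeromat_inj.
  + exact: zeromatD.
  + move=> A _; exists (size_of A); split=> [|l]; first exact/identity_indexP.
    by move=> /identity_indexP.
- move=> A l GA /identity_indexP ->; exists (hscale (- 1) A).
  by split; rewrite 1?[hadd (hscale _ _) _]haddC ?haddNr //; exact: GN.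
Qed.

Lemma hyper_group_setT : hyper_group (@hadd R) setT (@zeromat R).
Proof. exact: hyper_group_of_closed. Qed.

(** * Symmetric and skew-symmetric parts *)

Definition sympart c A : mat R := hscale (1 / 2) (hadd A (hscale c (htr A))).

Lemma pi_sE : @pi_s R = sympart 1.
Proof.
apply: funext => A; apply: mat_ext => [//|x y].
by rewrite !(step_hscale, step_hadd) !mul1r.
Qed.

Lemma pi_aE : @pi_a R = sympart (- 1).
Proof. by apply: funext => A; rewrite /pi_a hsubE. Qed.

Definition swap_join (l : msize) : msize := (l `|` ((l.2, l.1) : msize))%O.

Lemma swap_joinU l k : swap_join (l `|` k)%O = (swap_join l `|` swap_join k)%O.
Proof. by rewrite /swap_join joinACA. Qed.

Lemma size_sympart c A : size_of (sympart c A) = swap_join (size_of A).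
Proof. by rewrite size_hscale size_hadd. Qed.

Lemma step_sympart c A x y :
  step (sympart c A) x y = 1 / 2 * (step A x y + c * step A y x).
Proof. by rewrite !(step_hscale, step_hadd, step_htr). Qed.

Lemma sympartD c A B : sympart c (hadd A B) = hadd (sympart c A) (sympart c B).
Proof.
apply: mat_ext => [|x y].
  by rewrite size_sympart !size_hadd swap_joinU -!(size_sympart c).
rewrite step_hadd !step_sympart !step_hadd.
by rewrite -mulrDr (mulrDr c) addrACA.
Qed.

Lemma sympart_zeromat c l : sympart c (zeromat R l) = zeromat R (swap_join l).
Proof.
apply: mat_ext => [|x y]; first by rewrite size_sympart !size_zeromat.
by rewrite step_sympart !step_zeromat mulr0 addr0 mulr0.
Qed.

Lemma sympart_hom c :
  hyper_group_hom (@hadd R) setT (@zeromat R) (@hadd R) setT (@zeromat R)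
    (sympart c).
Proof.
split; [exact: hyper_group_setT | exact: hyper_group_setT | by [] | | |].
- by move=> A B _ _; exact: sympartD.
- by move=> _ [_ [l _ <-] <-]; exists (swap_join l) => //; rewrite sympart_zeromat.
- move=> l k l' k'; rewrite !sympart_zeromat => /zeromat_inj <- /zeromat_inj <-.
  by rewrite !leEjoin -swap_joinU => /eqP ->.
Qed.

Definition symker c : set (mat R) := [set A | mx (sympart c A) = 0].

Lemma symkerP c A :
  symker c A <-> forall x y, step A x y + c * step A y x = 0.
Proof.
split=> [/mx_eq0P A0 x y|A0].
  move: (A0 x y); rewrite step_sympart => /eqP.
  by rewrite mulf_eq0 mul1r invr_eq0 pnatr_eq0 => /eqP.
by apply/mx_eq0P => x y; rewrite step_sympart A0 mulr0.
Qed.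

Lemma hyper_group_symker c : hyper_group (@hadd R) (symker c) (@zeromat R).
Proof.
apply: hyper_group_of_closed => [l|A B|A].
- by apply/symkerP => x y; rewrite !step_zeromat mulr0 addr0.
- move=> /symkerP A0 /symkerP B0; apply/symkerP => x y.
  by rewrite !step_hadd mulrDr addrACA A0 B0 addr0.
- move=> /symkerP A0; apply/symkerP => x y.
  by rewrite !step_hscale (mulrCA c) -mulrDr A0 mulr0.
Qed.

Lemma pack_castmx m n m' n' (e : (m = m') * (n = n')) (A : 'M[R]_(m, n)) :
  pack (castmx e A) = pack A.
Proof. by case: e => em en; case: m' / em; case: n' / en. Qed.

Lemma pack_inflate m n s t (ms : (m %| s)%N) (nt : (n %| t)%N)
    (A : 'M[R]_(m, n)) :
  pack (inflate ms nt A) = pack (A *t normE R (s %/ m) (t %/ n)).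
Proof. exact: pack_castmx. Qed.

(** On the kernel of [sympart] c, the step function u of A satisfies
    c u(y, x) = - u(x, y), so [sympart] (-c) leaves it unchanged. *)
Lemma sympart_symker c m n A : (symker c `&` mats R m n) A ->
  pack (mx (sympart (- c) A))
  = pack (mx A *t normE R (lcmn m n %/ m)%N (lcmn m n %/ n)%N).
Proof.
case=> /symkerP A0 [<- <-].
set a := lcmn _ _.
have a0 : (0 < a)%N by rewrite lcmn_pos ?nrow_gt0 ?ncol_gt0.
rewrite -(pack_inflate (dvdn_lcml _ _ : (_ %| a)%N) (dvdn_lcmr _ _ : (_ %| a)%N)).
suff -> : sympart (- c) A
    = Mat a0 a0 (inflate (dvdn_lcml _ _) (dvdn_lcmr _ _) (mx A)) by [].
apply: mat_ext => [|x y]; first by apply: size_of_eq => //=; rewrite lcmnC.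
rewrite (step_inflate (nrow_gt0 A) (ncol_gt0 A)) step_sympart.
have -> : - c * step A y x = step A x y.
  by rewrite mulNr; apply/esym/eqP; rewrite -addr_eq0 A0.
case: (A) => *; rewrite -mulr2n -[X in _ * X]mulr_natl mulrA mul1r.
by rewrite mulVf ?pnatr_eq0 ?mul1r.
Qed.

Lemma symker_square c n (n0 : (0 < n)%N) :
  symker c `&` mats R n n
  = [set mat_of n0 n0 A | A in [set A : 'M[R]_n | A + c *: A^T = 0]].
Proof.
have sqP (A : 'M[R]_n) : symker c (mat_of n0 n0 A) <-> A + c *: A^T = 0.
  have stepE x y : step (Mat n0 n0 (A + c *: A^T)) x y
      = step (Mat n0 n0 A) x y + c * step (Mat n0 n0 A) y x.
    by rewrite step_addmx (step_hscale c (htr (Mat n0 n0 A))) step_htr.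
  have := mx_eq0P (Mat n0 n0 (A + c *: A^T)) => /= eq0.
  split=> [/symkerP A0|/eq0 A0].
    by apply/eq0 => x y; rewrite stepE; exact: A0.
  by apply/symkerP => x y; rewrite -stepE.
apply/seteqP; split=> [B [B0 /(mat_of_size n0 n0) [A BA]]|_ [A /sqP A0 <-]].
  by exists A => //; apply/sqP; rewrite -BA.
by split.
Qed.

End StepFunctions.

Theorem theorem5p12 (R : realType) :
  (* (i) *)
  (hyper_group_hom (@hadd R) setT (@zeromat R) (@hadd R) setT (@zeromat R)
     (@pi_s R)
   /\ hyper_group_hom (@hadd R) setT (@zeromat R) (@hadd R) setT (@zeromat R)
     (@pi_a R)
   /\ hyper_group (@hadd R) (Ks R) (@zeromat R)
   /\ hyper_group (@hadd R) (Ka R) (@zeromat R))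
  (* (ii) *)
  /\ (forall (m n : nat) (A : mat R), (Ks R `&` mats R m n) A ->
       let alpha := lcmn m n in
       pack (mx (pi_a A)) =
       pack (mx A *t normE R (alpha %/ m)%N (alpha %/ n)%N))
  (* (iii) *)
  /\ (forall (n : nat) (n0 : (0 < n)%N),
       Ks R `&` mats R n n =
       [set mat_of n0 n0 A | A in [set A : 'M[R]_n | A^T = - A]])
  (* (iv) *)
  /\ (forall (m n : nat) (A : mat R), (Ka R `&` mats R m n) A ->
       let alpha := lcmn m n in
       pack (mx (pi_s A)) =
       pack (mx A *t normE R (alpha %/ m)%N (alpha %/ n)%N))
  (* (v) *)
  /\ (forall (n : nat) (n0 : (0 < n)%N),
       Ka R `&` mats R n n =
       [set mat_of n0 n0 A | A in [set A : 'M[R]_n | A^T = A]]).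
Proof.
have KsE : Ks R = symker 1 by rewrite /symker -pi_sE.
have KaE : Ka R = symker (- 1) by rewrite /symker -pi_aE.
rewrite KsE KaE pi_sE pi_aE.
split; [split; [|split; [|split]]|split; [|split; [|split]]].
- exact: sympart_hom.
- exact: sympart_hom.
- exact: hyper_group_symker.
- exact: hyper_group_symker.
- by move=> m n A; exact: sympart_symker.
- move=> n n0; rewrite symker_square; congr (_ @` _); apply/seteqP.
  split=> A /=; rewrite scale1r addrC; last by move=> ->; rewrite addNr.
  by move/eqP; rewrite addr_eq0 => /eqP.
- by move=> m n A /sympart_symker; rewrite opprK.
- move=> n n0; rewrite symker_square; congr (_ @` _); apply/seteqP.
  split=> A /=; rewrite scaleN1r; last by move=> ->; rewrite subrr.
  by move/subr0_eq.
Qed.
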